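(* Let $G$ be a finite group, $S\subset G$ and $\Gamma^*=X^*(G,S)$. For every integer $\ell\ge 1$: (a) $\mathcal{E}_\ell(\Gamma^*_S)=2^\ell\,\mathcal{E}_\ell(\Gamma^* )$. (b) $\mathcal{E}_\ell(\Gamma^*_e)\le 2^\ell\big(\mathcal{E}_\ell(\Gamma^* )+|G|\big)$. (c) $\mathcal{E}_\ell(\Gamma^*_{S\cup e})\le 2^{2\ell-1}\mathcal{E}_\ell(\Gamma^* )+(2^{\ell-1}+1)|G|$.
   Context: $X(G,S)$ is the Cayley graph with vertex set $G$ and a directed edge from $h$ to $g$ iff $gh^{-1}\in S$; $X^+(G,S)$ is the Cayley sum graph with vertex set $G$ and a directed edge from $h$ to $g$ iff $gh\in S$ (loops allowed). $X^*(G,S)$ denotes either one; a statement with $*$ is asserted for both choices, the same choice being made throughout. Let $A$ be the adjacency matrix of $\Gamma^*=X^*(G,S)$ and $I$ the identity matrix. The mirror di-Cayley (sum) graphs below have vertex set $G\times\mathbb{Z}_2$ and the following adjacency matrices (in $|G|\times|G|$ blocks): $\Gamma^*_e=MX^*(G;S,\{e\})=\Gamma^*\Box P_2$ has $\begin{pmatrix}A&I\\ I&A\end{pmatrix}$; $\Gamma^*_S=MX^*(G;S,S)=\Gamma^*\times\mathring{P}_2$ has $\begin{pmatrix}A&A\\ A&A\end{pmatrix}$; $\Gamma^*_{S\cup e}=MX^*(G;S,S\cup\{e\})=\Gamma^*\boxtimes P_2$ has $\begin{pmatrix}A&A+I\\ A+I&A\end{pmatrix}$. Here $P_2$ is the 2-path,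 $\mathring{P}_2$ the 2-path with a loop at each vertex, and $\Box,\times,\boxtimes$ are the Cartesian, direct and strong products. Whenever $\Gamma^*_{S\cup e}$ is considered, it is assumed that $e\notin S$. $Spec$ is the multiset of complex eigenvalues of the adjacency matrix counted with (algebraic) multiplicity. The $\ell$-th energetic moment is $\mathcal{E}_\ell(\Gamma)=\sum_{\lambda\in Spec(\Gamma)}|\lambda|^\ell$. *)

(* Defs.v *)
From HB Require Import structures.
From mathcomp Require Import all_boot all_order all_algebra all_fingroup.

Set Implicit Arguments.
Unset Strict Implicit.
Unset Printing Implicit Defensive.

Import Order.TTheory GRing.Theory Num.Theory.
Local Open Scope ring_scope.

(* A finite directed graph is given by its edge multiplicities: [E u v] is the
   number of edges from [u] to [v].  Multiplicities (rather than a relation)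
   are needed for the strong product: a Cayley sum graph can have a loop at [h]
   even if [1 \notin S] (when [h * h \in S]), and then the matrix A + I has an
   entry 2 on its diagonal. *)
Definition digraph (V : finType) : Type := V -> V -> nat.

Inductive cayley_kind : Type := Cayley | CayleySum.

Definition cayley_graph (k : cayley_kind) (gT : finGroupType) (S : {set gT}) :
    digraph gT :=
  fun h g => match k with
             | Cayley => nat_of_bool ((g * h^-1)%g \in S)
             | CayleySum => nat_of_bool ((g * h)%g \in S)
             end.

Definition cartesian_prod (V W : finType) (E : digraph V) (F : digraph W) :
    digraph (V * W)%type :=
  fun u v => (E u.1 v.1 * (u.2 == v.2) + (u.1 == v.1) * F u.2 v.2)%N.

Definition direct_prod (V W : finType) (E : digraph V) (F : digraph W) :
    digraph (V * W)%type :=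
  fun u v => (E u.1 v.1 * F u.2 v.2)%N.

Definition strong_prod (V W : finType) (E : digraph V) (F : digraph W) :
    digraph (V * W)%type :=
  fun u v => (cartesian_prod E F u v + direct_prod E F u v)%N.

Definition path2 : digraph 'Z_2 := fun i j => nat_of_bool (i != j).

Definition looped_path2 : digraph 'Z_2 := fun _ _ => 1%N.

Section Mirror.
Variables (k : cayley_kind) (gT : finGroupType) (S : {set gT}).

(* MX^*(G; S, {e}), MX^*(G; S, S) and MX^*(G; S, S \cup {e}) *)
Definition mirror_e : digraph (gT * 'Z_2)%type :=
  cartesian_prod (cayley_graph k S) path2.

Definition mirror_S : digraph (gT * 'Z_2)%type :=
  direct_prod (cayley_graph k S) looped_path2.

Definition mirror_Se : digraph (gT * 'Z_2)%type :=
  strong_prod (cayley_graph k S) path2.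

(* The block forms (A, I; I, A), (A, A; A, A) and (A, A + I; A + I, A). *)
Lemma mirror_eE (h g : gT) (i j : 'Z_2) :
  mirror_e (h, i) (g, j) =
    if i == j then cayley_graph k S h g else (h == g).
Proof.
rewrite /mirror_e /cartesian_prod /path2 /=.
by case: (i == j); rewrite /= ?muln0 ?muln1 ?addn0 ?add0n.
Qed.

Lemma mirror_SE (h g : gT) (i j : 'Z_2) :
  mirror_S (h, i) (g, j) = cayley_graph k S h g.
Proof. by rewrite /mirror_S /direct_prod muln1. Qed.

Lemma mirror_SeE (h g : gT) (i j : 'Z_2) :
  mirror_Se (h, i) (g, j) =
    if i == j then cayley_graph k S h g
    else (cayley_graph k S h g + (h == g))%N.
Proof.
rewrite /mirror_Se /strong_prod /cartesian_prod /direct_prod /path2 /=.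
by case: (i == j); rewrite /= ?muln0 ?muln1 ?addn0 ?add0n // addnC.
Qed.

End Mirror.

Section Spectrum.
Variable C : numClosedFieldType.

Definition adjmx (V : finType) (E : digraph V) : 'M[C]_#|V| :=
  \matrix_(i, j) (E (enum_val i) (enum_val j))%:R.

(* The roots of the characteristic polynomial, repeated according to
   multiplicity; the order of the list is irrelevant. *)
Definition spec (V : finType) (E : digraph V) : seq C :=
  sval (closed_field_poly_normal (char_poly (adjmx E))).

Lemma specP (V : finType) (E : digraph V) :
  char_poly (adjmx E) = \prod_(z <- spec E) ('X - z%:P).
Proof.
rewrite /spec; case: closed_field_poly_normal => r /= {1}->.
by rewrite (monicP (char_poly_monic _)) scale1r.
Qed.

Definition energetic_moment (l : nat) (V : finType) (E : digraph V) : C :=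
  \sum_(z <- spec E) `|z| ^+ l.

End Spectrum.

(* Main.v *)
Require Import Defs.
From HB Require Import structures.
From mathcomp Require Import all_boot all_order all_algebra all_fingroup.
From mathcomp Require Import spectral ring.

Set Implicit Arguments.
Unset Strict Implicit.
Unset Printing Implicit Defensive.

Import Order.TTheory GRing.Theory Num.Theory.
Local Open Scope ring_scope.

(** Each of the three graphs consists of two copies of one graph, with adjacency
    matrix A, joined in both directions by the edges of another, whose matrix
    has the form aA + bI: (a, b) is (1, 0) for the direct product, (0, 1) for
    the Cartesian product and (1, 1) for the strong product.  Passing to sums
    and differences of the two copies block-triangularizes such a matrix, with
    diagonal blocks (1 + a)A + bI and (1 - a)A - bI
    ([char_poly_block_symm]).  Triangularizing A in turn shows that the
    eigenvalues of these blocks are the affine images of those of A, with the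
    same multiplicities ([char_poly_affine]).  So each eigenvalue z of A
    contributes the two eigenvalues (1 + a)z + b and (1 - a)z - b
    ([energetic_moment_two_layers]), that is
      2z and 0,   z + 1 and z - 1,   2z + 1 and -1
    respectively.  The first pair gives the equality (0 contributes nothing
    because l is positive); for the other two, the triangle inequality and the
    convexity of the l-th power give |x + y|^l <= 2^(l-1) (|x|^l + |y|^l)
    ([normD_exp_le]), and it remains to sum over the |G| eigenvalues. *)

(** * Characteristic polynomials of similar and of block matrices *)

Lemma char_poly_simmx (R : idomainType) n (P A B : 'M[R]_n) :
  P \in unitmx -> P *m A = B *m P -> char_poly A = char_poly B.
Proof.
move=> Pu PA; pose Q := map_mx polyC P.
have dQ : \det Q = (\det P)%:P by rewrite det_map_mx.
have eqQ : Q *m char_poly_mx A = char_poly_mx B *m Q.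
  rewrite /char_poly_mx mulmxBr mulmxBl -!map_mxM PA.
  by rewrite scalar_mxC.
have Q0 : \det Q != 0.
  by rewrite dQ polyC_eq0; apply: contraTneq Pu; rewrite unitmxE => ->; rewrite unitr0.
by apply: (mulfI Q0); rewrite -det_mulmx eqQ det_mulmx mulrC.
Qed.

Lemma char_poly_reindex (R : idomainType) m n (A : 'M[R]_m) (B : 'M[R]_n)
    (f : 'I_m -> 'I_n) :
  bijective f -> (forall i j, A i j = B (f i) (f j)) ->
  char_poly A = char_poly B.
Proof.
move=> bf; have eq_mn : m = n by rewrite -[m]card_ord (bij_eq_card bf) card_ord.
case: n / eq_mn B f bf => B f /bij_inj inj_f AE.
apply/esym/(@char_poly_simmx _ _ (perm_mx (perm inj_f))).
  exact: unitmx_perm.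
rewrite -row_permE -[in RHS](invgK (perm inj_f)) -col_permE; apply/matrixP=> i j.
by rewrite !mxE AE -[f (_ j)](permE inj_f) permKV permE.
Qed.

(** The conjugating matrix P replaces the first block of rows by the sum of the
    two; its inverse on the right then clears the upper right block. *)
Lemma char_poly_block_symm (R : idomainType) n (A B : 'M[R]_n) :
  char_poly (block_mx A B B A) = char_poly (A + B) * char_poly (A - B).
Proof.
pose P : 'M[R]_(n + n) := block_mx 1%:M 1%:M 0 1%:M.
have Pu : P \in unitmx by rewrite unitmxE det_ublock !det1 mulr1 unitr1.
rewrite (char_poly_simmx Pu (B := block_mx (A + B) 0 B (A - B))).
  rewrite /char_poly /char_poly_mx map_block_mx map_mx0 scalar_mx_block.
  by rewrite opp_block_mx add_block_mx oppr0 addr0 det_lblock.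
rewrite !mulmx_block !mul0mx !mulmx0 !mul1mx !mulmx1 !addr0 !add0r.
by rewrite [B + A]addrC subrKC.
Qed.

(** * Spectra of affine images and of two-layer graphs *)

Section AffineSpectrum.
Variable C : numClosedFieldType.

(** This holds with multiplicities because A is similar to a triangular matrix
    T, the same base change takes aA + bI to aT + bI, and the spectrum of a
    triangular matrix is its diagonal.  The case a = 0, in which all the
    eigenvalues collapse to b, is included. *)
Lemma char_poly_affine n (A : 'M[C]_n) (s : seq C) (a b : C) :
  char_poly A = \prod_(z <- s) ('X - z%:P) ->
  char_poly (a *: A + b%:M) = \prod_(z <- s) ('X - (a * z + b)%:P).
Proof.
have [|P Pu /=] := @cotrigonalization C n [:: A].
  by move=> ? ?; rewrite !inE => /eqP-> /eqP->.
have {}Pu := unitarymx_unit Pu.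
rewrite andbT /similar_to conjumx //; set T := P *m A *m _ => trigT.
have PA : P *m A = T *m P by rewrite mulmxKV.
clearbody T.
rewrite (char_poly_simmx Pu PA) char_poly_trig // => eq_s.
pose t := [seq T i i | i <- enum 'I_n].
have /(prod_XsubC_eq) st : \prod_(z <- t) ('X - z%:P) = \prod_(z <- s) ('X - z%:P).
  by rewrite -eq_s big_map big_enum.
rewrite -(perm_big _ st) big_map big_enum /=.
rewrite (char_poly_simmx Pu (B := a *: T + b%:M)).
  rewrite char_poly_trig; last first.
    apply/is_trig_mxP=> i j lt_ij; rewrite !mxE (is_trig_mxP trigT) //.
    by rewrite mulr0 add0r -val_eqE ltn_eqF.
  by apply: eq_bigr => i _; rewrite !mxE eqxx.
by rewrite mulmxDr mulmxDl -scalemxAr -scalemxAl PA scalar_mxC.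
Qed.

Lemma energetic_momentE l (V : finType) (E : digraph V) (s : seq C) :
  char_poly (adjmx C E) = \prod_(z <- s) ('X - z%:P) ->
  energetic_moment C l E = \sum_(z <- s) `|z| ^+ l.
Proof. by rewrite specP => /prod_XsubC_eq eq_s; exact: perm_big. Qed.

Lemma size_spec (V : finType) (E : digraph V) : size (spec C E) = #|V|.
Proof.
have := size_char_poly (adjmx C E).
by rewrite specP size_prod_XsubC => -[].
Qed.

(** The enumeration of the vertices of a product is not layer by layer, so the
    block form is only reached after renumbering them. *)
Lemma char_poly_two_layers (V : finType) (E : digraph (V * 'Z_2)%type)
    (F D : digraph V) :
  (forall h g i j, E (h, i) (g, j) = if i == j then F h g else D h g) ->
  char_poly (adjmx C E)
    = char_poly (block_mx (adjmx C F) (adjmx C D) (adjmx C D) (adjmx C F)).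
Proof.
move=> EE; pose layer (p : V * 'Z_2) : 'I_(#|V| + #|V|) :=
  if p.2 == 0 then lshift _ (enum_rank p.1) else rshift _ (enum_rank p.1).
have Z2P (i : 'Z_2) : (i == 0) || (i == 1) by case: i => [] [|[|]].
have inj_layer : injective layer.
  move=> [h i] [g j]; rewrite /layer /=.
  case/orP: (Z2P i) => /eqP->; case/orP: (Z2P j) => /eqP-> /=.
  - by move/lshift_inj/enum_rank_inj->.
  - by move/eqP; rewrite eq_lrshift.
  - by move/eqP; rewrite eq_rlshift.
  - by move/rshift_inj/enum_rank_inj->.
apply: (@char_poly_reindex _ _ _ _ _ (layer \o enum_val)).
  apply: inj_card_bij; first exact: inj_comp inj_layer enum_val_inj.
  by rewrite !card_ord card_prod card_ord muln2 addnn.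
move=> x y; rewrite mxE /=; case: (enum_val x) (enum_val y) => [h i] [g j].
rewrite EE /layer /=.
case/orP: (Z2P i) => /eqP->; case/orP: (Z2P j) => /eqP-> /=;
  by rewrite ?(block_mxEul, block_mxEur, block_mxEdl, block_mxEdr) mxE !enum_rankK.
Qed.

Lemma energetic_moment_two_layers l (V : finType) (E : digraph (V * 'Z_2)%type)
    (F D : digraph V) (a b : C) :
  (forall h g i j, E (h, i) (g, j) = if i == j then F h g else D h g) ->
  adjmx C D = a *: adjmx C F + b%:M ->
  energetic_moment C l E =
    \sum_(z <- spec C F)
       (`|(1 + a) * z + b| ^+ l + `|(1 - a) * z - b| ^+ l).
Proof.
move=> EE DE; rewrite big_split /=.
pose s := [seq (1 + a) * z + b | z <- spec C F]
            ++ [seq (1 - a) * z - b | z <- spec C F].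
rewrite (@energetic_momentE l _ E s) ?big_cat ?big_map //=.
rewrite (char_poly_two_layers EE) char_poly_block_symm DE.
rewrite -(char_poly_affine (1 + a) b (specP C F)).
rewrite -(char_poly_affine (1 - a) (- b) (specP C F)).
by rewrite addrA opprD addrA scalerDl scalerBl scale1r raddfN.
Qed.

(** * The energetic moments *)

(** Convexity of the l-th power, by induction on l from Chebyshev's inequality:
    x - y and x^l - y^l have the same sign, so that
    (x + y)(x^l + y^l) <= 2 (x^(l+1) + y^(l+1)). *)
Lemma exprD_le (x y : C) l : (0 < l)%N -> 0 <= x -> 0 <= y ->
  (x + y) ^+ l <= 2 ^+ l.-1 * (x ^+ l + y ^+ l).
Proof.
move=> l_gt0 x0 y0; elim: l l_gt0 => // -[|l] IHl _; first by rewrite !expr1 mul1r.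
have sum0 : 0 <= x + y by exact: addr_ge0.
rewrite exprS (le_trans (ler_wpM2l sum0 (IHl isT))) //=.
rewrite mulrCA [2 ^+ l.+1]exprSr -mulrA ler_wpM2l ?exprn_ge0 ?ler0n //.
have cheb : 0 <= (x - y) * (x ^+ l.+1 - y ^+ l.+1).
  have [xy|yx|->] := real_ltgtP (ger0_real x0) (ger0_real y0).
  - by rewrite mulr_le0 ?subr_le0 ?lerXn2r ?nnegrE // ltW.
  - by rewrite mulr_ge0 ?subr_ge0 ?lerXn2r ?nnegrE // ltW.
  - by rewrite subrr mul0r.
(* The difference of the two sides is exactly the product in [cheb]. *)
rewrite -subr_ge0; congr (_ <= _): cheb.
rewrite [x ^+ l.+2]exprS [y ^+ l.+2]exprS; ring.
Qed.

Lemma normD_exp_le (x y : C) l : (0 < l)%N ->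
  `|x + y| ^+ l <= 2 ^+ l.-1 * (`|x| ^+ l + `|y| ^+ l).
Proof.
move=> l_gt0; apply: le_trans (exprD_le l_gt0 (normr_ge0 x) (normr_ge0 y)).
by rewrite lerXn2r ?nnegrE ?addr_ge0 // ler_normD.
Qed.

End AffineSpectrum.

Theorem proposition3p3 (C : numClosedFieldType) (k : cayley_kind)
    (gT : finGroupType) (S : {set gT}) (l : nat) (hl : (1 <= l)%N) :
  [/\ energetic_moment C l (mirror_S k S)
        = 2 ^+ l * energetic_moment C l (cayley_graph k S),
      energetic_moment C l (mirror_e k S)
        <= 2 ^+ l * (energetic_moment C l (cayley_graph k S) + #|gT|%:R)
    & 1%g \notin S ->
      energetic_moment C l (mirror_Se k S)
        <= 2 ^+ (2 * l - 1) * energetic_moment C l (cayley_graph k S)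
           + (2 ^+ (l - 1) + 1) * #|gT|%:R].
Proof.
set F := cayley_graph k S; set n := #|gT|.
have idE : adjmx C (fun h g : gT => nat_of_bool (h == g)) = 1%:M.
  by apply/matrixP=> i j; rewrite !mxE (inj_eq enum_val_inj).
have sum_const (c : C) : \sum_(z <- spec C F) c = c * n%:R.
  by rewrite big_const_seq count_predT size_spec iter_addr_0 mulr_natr.
split=> [||_].
- rewrite (@energetic_moment_two_layers C l gT _ F F 1 0).
  + rewrite mulr_sumr; apply: eq_bigr => z _.
    by rewrite subrr mul0r subr0 normr0 expr0n (gtn_eqF hl) !addr0 -[1 + 1]/(2 : C)
      normrM exprMn normr_nat.
  + by move=> h g i j; rewrite mirror_SE; case: ifP.
  + by rewrite scale1r raddf0 addr0.
- rewrite (@energetic_moment_two_layers C l gT _ F _ 0 1 (@mirror_eE k gT S)).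
    rewrite mulrDr -sum_const mulr_sumr -big_split /=; apply: ler_sum => z _.
    have le1 (e : C) : `|e| = 1 -> `|z + e| ^+ l <= 2 ^+ l.-1 * (`|z| ^+ l + 1).
      by move=> e1; have := normD_exp_le z e hl; rewrite e1 expr1n.
    rewrite addr0 subr0 mul1r (le_trans (lerD (le1 _ _) (le1 _ _))) ?normrN1 ?normr1 //.
    by rewrite -mulrDl -mulr2n -[_ *+ 2]mulr_natl -exprS prednK // mulrDr mulr1.
  by rewrite scale0r add0r.
- rewrite (@energetic_moment_two_layers C l gT _ F _ 1 1 (@mirror_SeE k gT S)).
    rewrite -sum_const mulr_sumr -big_split /=; apply: ler_sum => z _.
    rewrite subrr mul0r sub0r normrN1 expr1n addrA lerD2r !subn1.
    apply: le_trans (normD_exp_le _ 1 hl) _.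
    rewrite normr1 expr1n normrM exprMn -[1 + 1]/(2 : C) normr_nat mulrDr mulr1.
    by rewrite mulrA -exprD -subn1 addnBAC // addnn -mul2n subn1.
  rewrite scale1r -idE; apply/matrixP=> i j.
  by rewrite !mxE natrD.
Qed.
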